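(* Let $\Omega\subset\mathbb{R}^2$ be a polygonal domain with a given triangular (simplex) mesh such that every internal angle of every triangle in the mesh does not exceed $\pi/2$. Let $A,M$ be the stiffness and mass matrices of the $P_1(\Omega)$ (continuous piecewise linear) finite-element discretization on this mesh, let $G$ be the graph associated to the mesh, let $B$ be the set of boundary nodes, and let $\mathcal{S}_{\rm in}(\lambda)$ be the space of inner solutions. Then, for every $\lambda\in\mathbb{R}$, $$\dim \mathcal{S}_{\rm in}(\lambda) \le \min\big\{ |S_I| : S_I\cup B \text{ is a zero forcing set for } G\big\}.$$ In particular, if $B$ is a zero forcing set for $G$, then the unique continuation principle holds for this discretization, i.e. $\mathcal{S}_{\rm in}(\lambda)=\{0\}$ for all $\lambda\in\mathbb{R}$.
   Context: Mesh: $\overline\Omega$ is covered by finitely many nonoverlapping nondegenerate closed triangles, whose vertices are the nodes $\{\boldsymbol{x}_i\}_{i=1}^n$; the mesh is conforming (edges do not cross, and two distinct triangles meet in a common edge, a common vertex, or not at all). $P_1$ discretization: for each node $\boldsymbol{x}_i$, $\phi_i$ is the continuous function on $\overline\Omega$ that is affine on each triangle and satisfies $\phi_i(\boldsymbol{x}_j)=\delta_{i,j}$. The stiffness and mass matrices are $a_{i,j}=\int_\Omega\nabla\phi_j\cdot\nabla\phi_i\,dA$ and $m_{i,j}=\int_\Omega\phi_j\phi_i\,dA$. Interior/boundary partition: $B$ is the set of nodes on $\partial\Omega$ (boundary nodes); the other nodes are interior nodes. With $n_I$ and $n_B$ the numbers of interior and boundary nodes, order the nodes with the interior ones first and write $$A=\begin{pmatrix}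 A_{II} & A_{IB} \\ A_{BI} & A_{BB} \end{pmatrix},\qquad M=\begin{pmatrix} M_{II} & M_{IB} \\ M_{BI} & M_{BB} \end{pmatrix}.$$ Inner solutions: $\mathcal{S}_{\rm in}(\lambda)=\ker(A_{II}-\lambda M_{II})\cap\ker(A_{BI}-\lambda M_{BI})\subset\mathbb{R}^{n_I}$. The discretization satisfies the unique continuation principle if $\mathcal{S}_{\rm in}(\lambda)=\{0\}$ for all $\lambda\in\mathbb{R}$. Graph of the mesh: $G=(V,E)$ with $V=\{\boldsymbol{x}_i\}_{i=1}^n$ and $E=\{(\boldsymbol{x}_i,\boldsymbol{x}_j): i\ne j,\ m_{i,j}>0\}$ (for a triangular mesh these are exactly the edges of the triangulation). Zero forcing set: given a graph $G=(V,E)$ and $S\subset V$, colour the vertices of $S$ blue and all others white. Apply repeatedly the rule: if a blue vertex has exactly one white neighbour, then that neighbour becomes blue; continue until no more changes are possible. $S$ is a zero forcing set if every vertex of $V$ ends up blue. *)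

(* Defs.v *)
(* The plane is R * R for R : realType, with its product topology. *)
From HB Require Import structures.
From mathcomp Require Import all_boot all_order all_algebra.
From mathcomp Require Import all_classical all_reals all_analysis.

Set Implicit Arguments.
Unset Strict Implicit.
Unset Printing Implicit Defensive.

Import Order.TTheory GRing.Theory Num.Theory.
Import numFieldNormedType.Exports.

Local Open Scope classical_set_scope.
Local Open Scope ring_scope.

Definition plane_measure (R : realType) :
    {measure set (measurableTypeR R * measurableTypeR R) -> \bar R} :=
  ((@lebesgue_measure R) \x (@lebesgue_measure R))%E.

Definition dot (R : realType) (p q : R * R) : R := p.1 * q.1 + p.2 * q.2.

(* The canonical norm of R * R is the max norm, hence this definition. *)
Definition enorm2 (R : realType) (p : R * R) : R := Num.sqrt (dot p p).

(* The angle at p between the segments [p, q] and [p, r]. *)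
Definition angle (R : realType) (p q r : R * R) : R :=
  acos (dot (q - p) (r - p) / (enorm2 (q - p) * enorm2 (r - p))).

Definition collinear (R : realType) (p q r : R * R) : Prop :=
  (q - p).1 * (r - p).2 = (q - p).2 * (r - p).1.

(* [derive] is a default value where the limit does not exist; for a P1
   function this concerns only points on the edges of the mesh, a null set. *)
Definition gradient (R : realType) (f : R * R -> R) (p : R * R) : R * R :=
  (derive f p ((1, 0) : R * R), derive f p ((0, 1) : R * R)).

Definition boundary (R : realType) (D : set (R * R)) : set (R * R) :=
  closure D `\` interior D.

Definition segment (R : realType) (p q : R * R) : set (R * R) :=
  [set (1 - t) *: p + t *: q | t in [set t : R | 0 <= t <= 1]].

Definition polygonal_domain (R : realType) (Omega : set (R * R)) : Prop :=
  [/\ open Omega, connected Omega, Omega !=set0, bounded_set Omega &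
      exists2 s : seq ((R * R) * (R * R)),
        (forall e, e \in s -> e.1 != e.2) &
        boundary Omega = \bigcup_(e in [set` s]) segment e.1 e.2].

Definition node_hull (R : realType) (n : nat) (x : 'I_n -> R * R)
    (t : {set 'I_n}) : set (R * R) :=
  [set p | exists w : 'I_n -> R,
    [/\ forall i, 0 <= w i, \sum_(i in t) w i = 1
      & p = \sum_(i in t) w i *: x i]].

(* A triangle is encoded by the set of indices of its three vertices; as a
   subset of the plane it is the convex hull of these vertices.  The last field
   also makes distinct triangles nonoverlapping. *)
Record triangular_mesh (R : realType) (Omega : set (R * R)) (n : nat)
    (x : 'I_n -> R * R) (T : {set {set 'I_n}}) : Prop := TriangularMesh {
  mesh_node_inj : injective x;
  mesh_node_vertex : forall i, exists2 t, t \in T & i \in t;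
  mesh_card3 : forall t, t \in T -> #|t| = 3%N;
  mesh_nondegenerate : forall i j k : 'I_n, [set i; j; k]%SET \in T ->
    ~ collinear (x i) (x j) (x k);
  mesh_cover : closure Omega = \bigcup_(t in [set` T]) node_hull x t;
  mesh_conforming : forall t t', t \in T -> t' \in T -> t != t' ->
    [\/ node_hull x t `&` node_hull x t' = set0,
        exists2 i, i \in t :&: t' &
          node_hull x t `&` node_hull x t' = [set x i]
      | exists i j, [/\ i != j, i \in t :&: t', j \in t :&: t' &
          node_hull x t `&` node_hull x t' = segment (x i) (x j)]]
}.

Definition nonobtuse_mesh (R : realType) (n : nat) (x : 'I_n -> R * R)
    (T : {set {set 'I_n}}) : Prop :=
  forall i j k : 'I_n, [set i; j; k]%SET \in T ->
    angle (x i) (x j) (x k) <= pi / 2.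

Definition affine_on (R : realType) (D : set (R * R)) (f : R * R -> R) : Prop :=
  exists (c : R) (g : R * R), forall p, D p -> f p = c + dot g p.

(* This determines each [phi i] on the closure of Omega only; its values
   elsewhere are irrelevant below because Omega is open. *)
Definition P1_basis (R : realType) (Omega : set (R * R)) (n : nat)
    (x : 'I_n -> R * R) (T : {set {set 'I_n}})
    (phi : 'I_n -> R * R -> R) : Prop :=
  forall i,
    [/\ {within closure Omega, continuous (phi i)},
        forall t, t \in T -> affine_on (node_hull x t) (phi i)
      & forall j, phi i (x j) = (i == j)%:R].

Definition stiffness (R : realType) (Omega : set (R * R)) (n : nat)
    (phi : 'I_n -> R * R -> R) : 'M[R]_n :=
  \matrix_(i, j) (\int[@plane_measure R]_(p in Omega)
    dot (gradient (phi j) p) (gradient (phi i) p)).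

Definition mass (R : realType) (Omega : set (R * R)) (n : nat)
    (phi : 'I_n -> R * R -> R) : 'M[R]_n :=
  \matrix_(i, j) (\int[@plane_measure R]_(p in Omega) (phi j p * phi i p)).

Definition boundary_nodes (R : realType) (Omega : set (R * R)) (n : nat)
    (x : 'I_n -> R * R) : {set 'I_n} :=
  [set i | `[< boundary Omega (x i) >]]%SET.

Definition interior_nodes_first (R : realType) (Omega : set (R * R))
    (nI nB : nat) (x : 'I_(nI + nB) -> R * R) : Prop :=
  (forall i : 'I_nI, ~ boundary Omega (x (lshift nB i))) /\
  (forall j : 'I_nB, boundary Omega (x (rshift nI j))).

Definition inner_solutions (R : realType) (nI nB : nat)
    (A M : 'M[R]_(nI + nB)) (lambda : R) : {vspace 'cV[R]_nI} :=
  (lker (linfun (mulmx (ulsubmx A - lambda *: ulsubmx M)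
           : 'cV[R]_nI -> 'cV[R]_nI)) :&:
   lker (linfun (mulmx (dlsubmx A - lambda *: dlsubmx M)
           : 'cV[R]_nI -> 'cV[R]_nB)))%VS.

Definition unique_continuation (R : realType) (nI nB : nat)
    (A M : 'M[R]_(nI + nB)) : Prop :=
  forall lambda : R, inner_solutions A M lambda = 0%VS.

Definition mesh_graph (R : realType) (n : nat) (M : 'M[R]_n) : rel 'I_n :=
  fun i j => (i != j) && (0 < M i j).

(* [colouring e S C]: C is the set of blue vertices at some stage of the
   colouring process of the graph e started from S. *)
Inductive colouring (V : finType) (e : rel V) (S : {set V}) : {set V} -> Prop :=
| ColouringStart : colouring e S S
| ColouringForce (C : {set V}) (v w : V) :
    colouring e S C -> v \in C ->
    ([set u | e v u] :\: C)%SET = [set w]%SET ->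
    colouring e S (w |: C)%SET.

Definition zero_forcing (V : finType) (e : rel V) (S : {set V}) : Prop :=
  colouring e S [set: V]%SET.

(* The minimum is taken over a nonempty family: since B together with its
   complement is everything, the default [~: B] satisfies the condition. *)
Definition min_zero_forcing_extension (V : finType) (e : rel V)
    (B : {set V}) : nat :=
  #|[arg min_(S < (~: B)%SET | (S \subset ~: B)%SET &&
                               `[< zero_forcing e (S :|: B)%SET >]) #|S|]|.

Lemma zero_forcing_setCU (V : finType) (e : rel V) (B : {set V}) :
  zero_forcing e (~: B :|: B)%SET.
Proof. by rewrite finset.setUC finset.setUCr; exact: ColouringStart. Qed.

Lemma min_zero_forcing_extensionP (V : finType) (e : rel V) (B : {set V}) :
  (exists2 S : {set V}, (S \subset ~: B)%SET /\ zero_forcing e (S :|: B)%SET &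
     min_zero_forcing_extension e B = #|S|) /\
  (forall S : {set V}, zero_forcing e (S :|: B)%SET ->
     (min_zero_forcing_extension e B <= #|S|)%N).
Proof.
rewrite /min_zero_forcing_extension; case: arg_minnP.
  by rewrite subxx; apply/asboolP; exact: zero_forcing_setCU.
move=> S0 /andP[S0B /asboolP zS0] minS0; split; first by exists S0.
move=> S zS; apply: (@leq_trans #|(S :\: B)%SET|).
  have SDB : (S :\: B :|: B = S :|: B)%SET.
    by apply/setP => v; rewrite !finset.in_setU finset.in_setD;
      case: (v \in B); rewrite ?orbT ?orbF.
  apply: minS0; rewrite SDB; apply/andP; split; last exact/asboolP.
  by rewrite finset.setDE finset.subsetIr.
exact/subset_leq_card/finset.subsetDl.
Qed.

(* Main.v *)
(* The matrix A - lambda M has the zero pattern of the graph off the diagonal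
   when lambda > 0: nonobtuse angles make the gradients of two distinct basis
   functions meet at a nonpositive inner product on each triangle, so a_ij <= 0,
   while m_ij > 0 on the edges.  An inner solution, extended by 0 to the
   boundary nodes, is in the kernel of A - lambda M; if it vanishes at a vertex
   and at all its neighbours but one, the row of this vertex makes it vanish at
   the last neighbour, so zero forcing propagates its zeros.  For lambda <= 0
   the energy v^T A v = lambda v^T M v is nonpositive, so v is constant on each
   triangle, and it vanishes because it does so on the boundary nodes.
   Integrals over Omega are computed off the lines through pairs of nodes:
   these lines form a closed null set, and off it every basis function is
   locally affine. *)
Require Import Defs.
From HB Require Import structures.
From mathcomp Require Import all_boot all_order all_algebra.
From mathcomp Require Import all_classical all_reals all_analysis.
From mathcomp Require Import measurable_realfun zify ring lra.

Set Implicit Arguments.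
Unset Strict Implicit.
Unset Printing Implicit Defensive.

Import Order.TTheory GRing.Theory Num.Theory.
Import numFieldNormedType.Exports.

Local Open Scope classical_set_scope.
Local Open Scope ring_scope.

(** * Lebesgue measure on the plane *)

Section null_sets.
Context d (T : measurableType d) (R : realType).
Variable mu : {measure set T -> \bar R}.

Import HBNNSimple.

(** The integral is a supremum over simple functions below [f]. Multiplying one of them by the
    indicator of the complement of [N] keeps its integral and places it below [f] cut down to the
    smaller domain. *)
Lemma ge0_integral_setD_null (D N : set T) (f : T -> \bar R) :
  measurable N -> mu N = 0%E -> (forall x, (0 <= f x)%E) ->
  (\int[mu]_(x in D) f x = \int[mu]_(x in D `\` N) f x)%E.
Proof.
move=> mN N0 f0; rewrite !ge0_integralE//.
apply/eqP; rewrite eq_le; apply/andP; split.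
  apply: ge_ereal_sup => _ [h /= hf <-]; apply: ereal_sup_ubound.
  exists (proj_nnsfun h (measurableC mN)) => /=.
    move=> x; have := hf x; rewrite /patch /= /measurable_realfun.mindic indicE.
    have [xN|xN] := boolP (x \in ~` N); last first.
      by rewrite mulr0 => _; case: ifP.
    by rewrite mulr1 in_setD -in_setC xN andbT.
  have sintE (g : {nnsfun T >-> R}) :
      sintegral mu g = (\int[mu]_(x in setT) (g x)%:E)%E.
    by rewrite integral_nnsfun// patch_setT.
  rewrite [LHS]sintE sintE.
  apply: ae_eq_integral => //.
  - exact/measurable_EFinP.
  - exact/measurable_EFinP.
  exists N; split => // x /= /not_implyP[_]; apply: contra_notP => xN.
  by rewrite /measurable_realfun.mindic indicE mem_set// mulr1.
apply: le_ereal_sup => _ [h /= hf <-]; exists h => // x.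
apply: (le_trans (hf x)); rewrite /patch.
by rewrite in_setD; case: (x \in D) => //=; case: ifP.
Qed.

(* No measurability of [f] is needed: it is bounded by simple functions
   only from below, and these may be set to 0 on the null set. *)
Lemma integral_setD_null (D N : set T) (f : T -> \bar R) :
  measurable N -> mu N = 0%E ->
  (\int[mu]_(x in D) f x = \int[mu]_(x in D `\` N) f x)%E.
Proof.
move=> mN N0; rewrite integralE [RHS]integralE.
by congr (_ - _)%E; apply: ge0_integral_setD_null.
Qed.

Lemma Rintegral_setD_null (D N : set T) (f : T -> R) :
  measurable N -> mu N = 0%E ->
  \int[mu]_(x in D) f x = \int[mu]_(x in D `\` N) f x.
Proof. by move=> mN N0; congr fine; exact: integral_setD_null. Qed.

End null_sets.

Section plane_lebesgue.
Variable R : realType.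
Implicit Types (U W : set (R * R)) (p q : R * R) (f : R * R -> R).

Local Notation plane := (measurableTypeR R * measurableTypeR R)%type.
Local Notation mu := (@plane_measure R).

Lemma open_plane_ball U p : open U -> U p ->
  exists2 e : R, 0 < e & forall q, `|p.1 - q.1| < e -> `|p.2 - q.2| < e -> U q.
Proof.
move=> oU Up; have /nbhs_ballP[e /= e0 eU] : nbhs p U by exact: open_nbhs_nbhs.
by exists e => // q q1 q2; apply: eU; split.
Qed.

Let box (a b c d : R) : set plane := (`]a, b[ `*` `]c, d[)%classic.

(** Links the topology to the product sigma-algebra: an open set is the union of the countably many
    boxes with rational corners that it contains. *)
Lemma open_plane_measurable U : open U -> measurable (U : set plane).
Proof.
move=> oU.
(* [n] encodes the four rational bounds of a box; invalid codes and boxes that leave [U] contribute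
   the empty set. *)
pose F (n : nat) : set plane :=
  if unpickle n is Some (a, b, c, d) then
    let V := box (ratr a) (ratr b) (ratr c) (ratr d) in
    if `[< V `<=` U >] then V else set0
  else set0.
have mF n : measurable (F n).
  rewrite /F; case: unpickle => [[[[a b] c] d]|]; last exact: measurable0.
  case: ifP => _; last exact: measurable0.
  by apply: measurableX; exact: measurable_itv.
suff -> : U = \bigcup_n F n by exact: bigcupT_measurable.
apply/seteqP; split => [p Up|p [n _]]; last first.
  rewrite /F; case: unpickle => [[[[a b] c] d]|//].
  by case: ifPn => // /asboolP VU /VU.
have [e e0 eU] := open_plane_ball oU Up.
have itv_rat (y : R) : exists a b : rat,
    [/\ y - e < ratr a, ratr a < y, y < ratr b & ratr b < y + e].
  have /rat_in_itvoo[a] : y - e < y by lra.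
  have /rat_in_itvoo[b] : y < y + e by lra.
  rewrite !in_itv/= => /andP[b1 b2] /andP[a1 a2]; by exists a, b.
have [a [b [a1 a2 b1 b2]]] := itv_rat p.1.
have [c [d [c1 c2 d1 d2]]] := itv_rat p.2.
have [n En] : exists n, unpickle n = Some (a, b, c, d).
  by exists (pickle (a, b, c, d)); rewrite pickleK.
exists n; [by []|rewrite /F En /=].
case: ifPn => [_|/asboolPn].
  by split => /=; rewrite in_itv/=; apply/andP.
case=> q [/=]; rewrite !in_itv/= => /andP[qa qb] /andP[qc qd].
by apply: eU; rewrite ltr_norml; apply/andP; split; lra.
Qed.

Lemma closed_plane_measurable U : closed U -> measurable (U : set plane).
Proof.
by move=> /closed_openC/open_plane_measurable/measurableC; rewrite setCK.
Qed.

Lemma plane_measureX (A B : set (measurableTypeR R)) :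
  measurable A -> measurable B ->
  mu (A `*` B)%classic = (lebesgue_measure A * lebesgue_measure B)%E.
Proof. by move=> mA mB; rewrite -product_measure1E. Qed.

Lemma plane_measure_gt0 U p : open U -> U p -> (0 < mu U)%E.
Proof.
move=> oU Up; have [e e0 eU] := open_plane_ball oU Up.
pose V := box (p.1 - e) (p.1 + e) (p.2 - e) (p.2 + e).
have mV : measurable V by apply: measurableX; exact: measurable_itv.
apply: (@lt_le_trans _ _ (mu V)); last first.
  apply: le_measure; rewrite ?inE//; first exact: open_plane_measurable.
  move=> q [/=]; rewrite !in_itv/= => /andP[qa qb] /andP[qc qd].
  by apply: eU; rewrite ltr_norml; apply/andP; split; lra.
rewrite plane_measureX; [|exact: measurable_itv..].
have itvE (y : R) :
      lebesgue_measure (`]y - e, y + e[%classic : set R) = (e + e)%:E.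
  rewrite lebesgue_measure_itv/= lte_fin ifT; last lra.
  by rewrite -EFinB; congr EFin; ring.
by rewrite !itvE -EFinM lte_fin; apply: mulr_gt0; lra.
Qed.

Lemma plane_measure_bounded U : open U -> bounded_set U -> (mu U < +oo)%E.
Proof.
move=> oU [M [Mreal bU]]; pose e : R := `|M| + 1.
have UM q : U q -> `|q.1| <= e /\ `|q.2| <= e.
  move=> Uq; have : `|q| <= e.
    by apply: bU => //; rewrite /e; have := ler_norm M; lra.
  by rewrite prod_normE ge_max => /andP[].
pose V : set plane := (`[- e, e] `*` `[- e, e])%classic.
have mV : measurable V by apply: measurableX; exact: measurable_itv.
apply: (@le_lt_trans _ _ (mu V)).
  apply: le_measure; rewrite ?inE//; first exact: open_plane_measurable.
  by move=> q /UM[q1 q2]; split; rewrite /= in_itv/= -ler_norml.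
rewrite plane_measureX; [|exact: measurable_itv..].
have e0 : - e < e by rewrite /e; have := normr_ge0 M; lra.
by rewrite !lebesgue_measure_itv/= lte_fin e0 -EFinB -EFinM ltry.
Qed.

Lemma plane_continuous_measurable W f : open W ->
  (forall p, W p -> {for p, continuous f}) -> measurable_fun (W : set plane) f.
Proof.
move=> oW cf; apply: (measurability _ (RGenOpens.measurableE R)).
move=> _ [_ [a [b ->] <-]]; apply: open_plane_measurable.
rewrite openE => p [Wp fp]; apply: filterI.
  by move: oW; rewrite openE; exact.
by apply: (cf p Wp); apply: open_nbhs_nbhs; split => //; exact: interval_open.
Qed.

Lemma plane_integrable W f (M : R) : open W -> (mu W < +oo)%E ->
  (forall p, W p -> {for p, continuous f}) -> (forall p, W p -> `|f p| <= M) ->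
  mu.-integrable (W : set plane) (EFin \o f).
Proof.
move=> oW Woo cf fM; apply: measurable_bounded_integrable => //.
- exact: open_plane_measurable.
- exact: plane_continuous_measurable.
exists M; split; first exact: num_real.
by move=> N MN p Wp; exact/(le_trans (fM p Wp))/ltW.
Qed.

(** By continuity [f] exceeds [f p / 2] on an open neighbourhood of [p], which has positive
    measure. *)
Lemma plane_Rintegral_gt0 W f p : open W -> W p ->
  mu.-integrable (W : set plane) (EFin \o f) ->
  (forall q, W q -> 0 <= f q) -> {for p, continuous f} -> 0 < f p ->
  0 < \int[mu]_(q in W) f q.
Proof.
move=> oW Wp intf f0 cf fp.
have mW := open_plane_measurable oW.
have /nbhs_ballP[e /= e0 eU] : nbhs p (W `&` [set q | f p / 2 < f q]).
  apply: filterI; first exact: open_nbhs_nbhs.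
  by apply: (cf [set y | f p / 2 < y]); apply: lt_nbhsr; lra.
pose V := interior (ball p e).
have oV : open V by exact: open_interior.
have Vp : V p by apply/nbhsx_ballx.
have mV := open_plane_measurable oV.
have VW : V `<=` W by move=> q /interior_subset/eU[].
have Vf q : V q -> f p / 2 < f q by move=> /interior_subset/eU[].
have intV : (\int[mu]_(q in V) (f p / 2)%:E <= \int[mu]_(q in W) (f q)%:E)%E.
  apply: (@le_trans _ _ (\int[mu]_(q in V) (f q)%:E)%E).
    apply: ge0_le_integral => //.
    - by move=> q _; rewrite lee_fin; lra.
    - apply/measurable_EFinP; apply: (measurable_funS mW) => //.
      by apply/measurable_EFinP; exact: measurable_int intf.
    - by move=> q Vq; rewrite lee_fin ltW// Vf.
  apply: ge0_subset_integral => //.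
  exact: measurable_int intf.
rewrite /Rintegral fine_gt0//; apply/andP; split.
  apply: lt_le_trans intV; rewrite integral_cst//.
  by apply: mule_gt0; [rewrite lte_fin; lra|exact: plane_measure_gt0 Vp].
by have := integrable_fin_num mW intf; rewrite ge0_fin_numE// integral_ge0.
Qed.

(** A vertical line lies in a product with a singleton factor; any other line meets each vertical
    line in at most one point, so the product measure integrates zero. *)
Lemma plane_line_null (a b : R * R) : a != b ->
  closed [set p | collinear a b p] /\ mu [set p | collinear a b p] = 0%E.
Proof.
move=> ab.
have cl : closed [set p | collinear a b p].
  have -> : [set p | collinear a b p] = (fun p : R * R =>
      (b.1 - a.1) * (p.2 - a.2) - (b.2 - a.2) * (p.1 - a.1)) @^-1` [set 0].
    apply/seteqP; split => p; rewrite /collinear /=.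
      by move=> ->; rewrite subrr.
    by move=> /eqP; rewrite subr_eq0 => /eqP.
  apply: closed_comp => [p _|]; last exact: (@closed_eq R 0).
  apply: cvgB; (apply: cvgM; [exact: cvg_cst|apply: cvgB; last exact: cvg_cst]).
    exact: cvg_snd.
  exact: cvg_fst.
split=> //.
have ml := closed_plane_measurable cl.
have [ab1|ab1] := eqVneq (b.1 - a.1) 0.
  have ab2 : b.2 - a.2 != 0.
    apply: contra ab => /eqP ab2; apply/eqP.
    by rewrite (surjective_pairing a) (surjective_pairing b); congr pair; lra.
  apply/eqP; rewrite eq_le measure_ge0 andbT.
  apply: (@le_trans _ _ (mu ([set a.1] `*` setT))).
    apply: le_measure; rewrite ?inE//; first exact: measurableX.
    move=> p /=; rewrite /collinear /= ab1 mul0r => /esym/eqP.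
    by rewrite mulf_eq0 (negbTE ab2)/= subr_eq0 => /eqP ->.
  by rewrite plane_measureX// lebesgue_measure_set1 mul0e.
rewrite -[LHS]/(\int[lebesgue_measure]_y
  lebesgue_measure (xsection [set p | collinear a b p] y))%E.
apply: integral0_eq => y _ /=.
apply/eqP; rewrite eq_le measure_ge0 andbT.
(* [z] is the ordinate of the line at abscissa [y]. *)
pose z : R := a.2 + (b.2 - a.2) * (y - a.1) / (b.1 - a.1).
rewrite -(lebesgue_measure_set1 z).
apply: le_measure; rewrite ?inE//; first exact: measurable_xsection.
move=> t; rewrite /xsection /= inE /collinear /= => h; rewrite /z -h.
by field.
Qed.

End plane_lebesgue.

(** * Plane geometry *)

Section plane_geometry.
Variable R : realType.
Implicit Types (a b c g p q : R * R) (f : R * R -> R).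

Lemma dotDr a b c : dot a (b + c) = dot a b + dot a c.
Proof. by rewrite /dot /=; ring. Qed.

Lemma dotZr (k : R) a b : dot a (k *: b) = k * dot a b.
Proof. by rewrite /dot /= /GRing.scale /=; ring. Qed.

Lemma dotBr a b c : dot a (b - c) = dot a b - dot a c.
Proof. by rewrite /dot /=; ring. Qed.

Lemma dot0r a : dot a 0 = 0.
Proof. by rewrite /dot /= !mulr0 addr0. Qed.

Lemma dot_sumr (I : finType) (P : pred I) a (F : I -> R * R) :
  dot a (\sum_(i | P i) F i) = \sum_(i | P i) dot a (F i).
Proof.
apply: (big_morph (dot a)); [exact: dotDr|exact: dot0r].
Qed.

Lemma dotC a b : dot a b = dot b a.
Proof. by rewrite /dot; ring. Qed.

Lemma dotZl (k : R) a b : dot (k *: a) b = k * dot a b.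
Proof. by rewrite dotC dotZr dotC. Qed.

Lemma dot_suml (I : finType) (P : pred I) a (F : I -> R * R) :
  dot (\sum_(i | P i) F i) a = \sum_(i | P i) dot (F i) a.
Proof. by rewrite dotC dot_sumr; apply: eq_bigr => i _; rewrite dotC. Qed.

Lemma dot_ge0 a : 0 <= dot a a.
Proof. by rewrite /dot -!expr2 addr_ge0// sqr_ge0. Qed.

Lemma dot_eq0 a : dot a a = 0 -> a = 0.
Proof.
rewrite /dot -!expr2 => /eqP.
rewrite paddr_eq0 ?sqr_ge0// !sqrf_eq0 => /andP[/eqP a1 /eqP a2].
by rewrite (surjective_pairing a) a1 a2.
Qed.

(** Lagrange's identity: after squaring, the gap is the square of the cross product. *)
Lemma dot_Cauchy_Schwarz a b : `|dot a b| <= enorm2 a * enorm2 b.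
Proof.
rewrite -sqrtr_sqr /enorm2 -sqrtrM ?dot_ge0// ler_wsqrtr// -subr_ge0.
have -> : dot a a * dot b b - dot a b ^+ 2 = (a.1 * b.2 - a.2 * b.1) ^+ 2.
  by rewrite /dot; ring.
exact: sqr_ge0.
Qed.

(** A negative dot product would force both sides to have positive length, so the quotient is a
    genuine cosine; it is nonnegative for an angle between 0 and [pi / 2]. *)
Lemma angle_nonobtuse p q r : angle p q r <= pi / 2 -> 0 <= dot (q - p) (r - p).
Proof.
rewrite /angle; set u := q - p; set v := r - p => angle_le.
rewrite leNgt; apply/negP => uv0.
have nuv : 0 < enorm2 u * enorm2 v.
  by apply: lt_le_trans (dot_Cauchy_Schwarz u v); rewrite normr_gt0 lt_eqF.
have y1 : -1 <= dot u v / (enorm2 u * enorm2 v) <= 1.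
  by rewrite -ler_norml normrM normfV (gtr0_norm nuv) ler_pdivrMr// mul1r
    dot_Cauchy_Schwarz.
have [/andP[acos0 _] cosE] := acos_def y1.
have : 0 <= cos (acos (dot u v / (enorm2 u * enorm2 v))).
  apply: cos_ge0_pihalf; rewrite angle_le andbT (le_trans _ acos0)//.
  by rewrite oppr_le0 divr_ge0// pi_ge0.
by rewrite cosE pmulr_lge0 ?invr_gt0// leNgt uv0.
Qed.

(** With [G] the determinant of [g] and [g'], the vectors [G *: a] and [G *: b] are [g'] and [g]
    turned by opposite quarter turns, whence [dot g g' = - (G ^+ 2 * dot a b)]. *)
Lemma dual_basis_dot_le0 a b g g' : dot g a = 1 -> dot g b = 0 ->
  dot g' a = 0 -> dot g' b = 1 -> 0 <= dot a b -> dot g g' <= 0.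
Proof.
move=> ga gb g'a g'b ab.
pose G := g.1 * g'.2 - g.2 * g'.1.
have a1 : G * a.1 = g'.2.
  have -> : G * a.1 = dot g a * g'.2 - g.2 * dot g' a by rewrite /G /dot; ring.
  by rewrite ga g'a; ring.
have a2 : G * a.2 = - g'.1.
  have -> : G * a.2 = dot g' a * g.1 - g'.1 * dot g a by rewrite /G /dot; ring.
  by rewrite ga g'a; ring.
have b1 : G * b.1 = - g.2.
  have -> : G * b.1 = dot g b * g'.2 - g.2 * dot g' b by rewrite /G /dot; ring.
  by rewrite gb g'b; ring.
have b2 : G * b.2 = g.1.
  have -> : G * b.2 = dot g' b * g.1 - g'.1 * dot g b by rewrite /G /dot; ring.
  by rewrite gb g'b; ring.
have -> : dot g g' = - (G ^+ 2 * dot a b).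
  have -> : G ^+ 2 * dot a b = (G * a.1) * (G * b.1) + (G * a.2) * (G * b.2).
    by rewrite /dot; ring.
  by rewrite a1 a2 b1 b2 /dot; ring.
by rewrite oppr_le0 mulr_ge0// sqr_ge0.
Qed.

(** Twice the signed area of the triangle [a], [b], [c]. *)
Definition det2 a b c : R :=
  (b.1 - a.1) * (c.2 - a.2) - (b.2 - a.2) * (c.1 - a.1).

Lemma collinearE a b c : collinear a b c <-> det2 a b c = 0.
Proof.
rewrite /collinear /det2 /=; split => [->|/eqP]; first by rewrite subrr.
by rewrite subr_eq0 => /eqP.
Qed.

Lemma det2_cycle a b c : det2 b c a = det2 a b c.
Proof. by rewrite /det2; ring. Qed.

(** The barycentric coordinate of [p] at the vertex [a], as a ratio of signed areas; cyclic
    permutations of [a], [b], [c] give the other two. *)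
Definition bary a b c p := det2 p b c / det2 a b c.

Lemma bary_continuous a b c : continuous (bary a b c).
Proof.
move=> p; apply: cvgMr_tmp; rewrite /det2.
by apply: cvgB; apply: cvgM; apply: cvgB;
  first [exact: cvg_cst|exact: cvg_fst|exact: cvg_snd].
Qed.

Lemma bary_sum a b c p : det2 a b c != 0 ->
  bary a b c p + bary b c a p + bary c a b p = 1.
Proof.
by rewrite /bary (det2_cycle a) -(det2_cycle c) => d0; rewrite /det2 in d0 *; field.
Qed.

Lemma bary_comb a b c p : det2 a b c != 0 ->
  p = bary a b c p *: a + bary b c a p *: b + bary c a b p *: c.
Proof.
rewrite /bary (det2_cycle a) -(det2_cycle c) => d0; rewrite /det2 in d0 *.
by apply: injective_projections; rewrite /= /GRing.scale /=; field.
Qed.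

Lemma bary_of_comb a b c (r s t : R) : det2 a b c != 0 -> r + s + t = 1 ->
  bary a b c (r *: a + s *: b + t *: c) = r.
Proof.
move=> d0 rst; have -> : t = 1 - r - s by lra.
rewrite /bary /det2 in d0 *; rewrite /= /GRing.scale /=.
by field.
Qed.

(** The formula is asked near [p] only, since basis functions are affine one triangle at a time. The
    difference quotient of the affine formula is constant for nonzero increments. *)
Lemma derive_affine f (k : R) g p v : (\forall q \near p, f q = k + dot g q) ->
  derive f p v = dot g v.
Proof.
move=> fE.
rewrite (near_eq_derive _ fE) /derive; apply: cvg_lim => //.
apply: cvg_near_cst; near=> h.
have h0 : h != 0 by near: h; exact: nbhs_dnbhs_neq.
rewrite /= /dot /GRing.scale /=.
rewrite -[h *: v.1]/(h * v.1) -[h *: v.2]/(h * v.2); by field.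
Unshelve. all: by end_near. Qed.

Lemma gradient_affine f (k : R) g p : (\forall q \near p, f q = k + dot g q) ->
  gradient f p = g.
Proof.
move=> fE; rewrite /gradient !(derive_affine _ fE) /dot /=.
by rewrite !mulr1 !mulr0 addr0 add0r -surjective_pairing.
Qed.

Lemma continuous_affine f (k : R) g p : (\forall q \near p, f q = k + dot g q) ->
  {for p, continuous f}.
Proof.
move=> fE; have fp := nbhs_singleton fE.
rewrite /prop_for /continuous_at fp.
apply: (@cvg_trans _ ((fun q => k + dot g q) @ p)).
  apply: near_eq_cvg; near=> q; apply/esym; near: q; exact: fE.
have aff_cont : continuous (fun q => k + dot g q).
  move=> q; apply: cvgD; first exact: cvg_cst.
  apply: cvgD; apply: cvgM; first [exact: cvg_cst|exact: cvg_fst|exact: cvg_snd].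
exact: aff_cont.
Unshelve. all: by end_near. Qed.

End plane_geometry.

(** * Triangular meshes and their P1 functions *)

Lemma set3_of_card3 (n : nat) (t : {set 'I_n}) i j :
  #|t| = 3%N -> i \in t -> j \in t -> i != j ->
  exists k, [/\ t = [set i; j; k]%SET, k != i & k != j].
Proof.
move=> t3 it jt ij.
have : #|t :\ i :\ j|%SET == 1%N.
  have jti : j \in (t :\ i)%SET by rewrite !inE eq_sym ij.
  by have := cardsD1 i t; have := cardsD1 j (t :\ i)%SET; rewrite t3 it jti; lia.
move=> /cards1P[k tk].
have : k \in (t :\ i :\ j)%SET by rewrite tk finset.set11.
rewrite !inE => /and3P[kj ki kt].
exists k; split => //; apply/setP => l; rewrite !inE.
have := f_equal (fun A : {set 'I_n} => l \in A) tk; rewrite !inE.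
case: (eqVneq l i) => [->//|_].
by case: (eqVneq l j) => [->//|_] /=.
Qed.

Lemma sum_set3 (V : nmodType) (n : nat) (F : 'I_n -> V) i j k :
  i != j -> k != i -> k != j ->
  \sum_(l in [set i; j; k]%SET) F l = F i + F j + F k.
Proof.
move=> ij ki kj.
rewrite finset.setUC big_setU1/= ?inE ?negb_or ?ki ?kj//.
by rewrite big_setU1/= ?inE// big_set1 addrC.
Qed.

Lemma node_hull3P (R : realType) (n : nat) (x : 'I_n -> R * R) i j k p :
  i != j -> k != i -> k != j ->
  node_hull x [set i; j; k]%SET p <->
  exists r s u, [/\ 0 <= r, 0 <= s, 0 <= u, r + s + u = 1 &
    p = r *: x i + s *: x j + u *: x k].
Proof.
move=> ij ki kj; split => [[w [w0 w1 ->]]|[r [s [u [r0 s0 u0 rsu ->]]]]].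
  by exists (w i), (w j), (w k); move: w1; rewrite !sum_set3.
exists (fun l => if l == i then r else if l == j then s else u).
split; first by move=> l; case: ifP => // _; case: ifP.
  by rewrite sum_set3// !eqxx (eq_sym j) (negbTE ij) (negbTE ki) (negbTE kj).
by rewrite sum_set3// !eqxx (eq_sym j) (negbTE ij) (negbTE ki) (negbTE kj).
Qed.

Lemma node_hull_vertex (R : realType) (n : nat) (x : 'I_n -> R * R)
  (t : {set 'I_n}) i : i \in t -> node_hull x t (x i).
Proof.
move=> it; exists (fun l => (l == i)%:R); split.
- by move=> l; case: (l == i).
- rewrite (bigD1 i)//= eqxx big1 ?addr0// => l /andP[_ /negbTE ->//].
- rewrite (bigD1 i)//= eqxx scale1r big1 ?addr0// => l /andP[_ /negbTE ->//].
  by rewrite scale0r.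
Qed.

(** * The lines through pairs of nodes, and the points off them *)

Section mesh.
Variables (R : realType) (Omega : set (R * R)) (n : nat).
Variables (x : 'I_n -> R * R) (T : {set {set 'I_n}}).
Hypothesis oOmega : open Omega.
Hypothesis bOmega : bounded_set Omega.
Hypothesis meshT : triangular_mesh Omega x T.

Local Notation mu := (@plane_measure R).

(** Whole lines replace the edges, even where they cut through other triangles: [plane_line_null]
    applies to them, and cutting a triangle further keeps the basis functions affine on the
    pieces. *)
Definition mesh_lines : set (R * R) :=
  \big[setU/set0]_(ij : 'I_n * 'I_n | ij.1 != ij.2)
    [set p | collinear (x ij.1) (x ij.2) p].

Definition mesh_interior := Omega `\` mesh_lines.

Lemma mesh_linesP p : mesh_lines p <->
  exists i j, i != j /\ collinear (x i) (x j) p.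
Proof.
rewrite /mesh_lines -bigcup_seq_cond; split => [[[i j] /= /andP[_ ij] c]|].
  by exists i, j.
by move=> [i [j [ij c]]]; exists (i, j); rewrite //= mem_index_enum.
Qed.

Lemma mesh_lines_closed : closed mesh_lines.
Proof.
apply: (big_ind closed) => [||ij ijn]; [exact: closed0|exact: closedU|].
by apply: (plane_line_null _).1;
  apply: contra ijn => /eqP/(mesh_node_inj meshT)/eqP.
Qed.

Lemma mesh_lines_measurable :
  measurable (mesh_lines : set (measurableTypeR R * measurableTypeR R)).
Proof. by apply: closed_plane_measurable; exact: mesh_lines_closed. Qed.

Lemma mesh_lines_null : mu mesh_lines = 0%E.
Proof.
have lineP (ij : 'I_n * 'I_n) : ij.1 != ij.2 ->
    closed [set p | collinear (x ij.1) (x ij.2) p] /\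
    mu [set p | collinear (x ij.1) (x ij.2) p] = 0%E.
  move=> ijn; apply: plane_line_null.
  by apply: contra ijn => /eqP/(mesh_node_inj meshT)/eqP.
pose P (A : set (measurableTypeR R * measurableTypeR R)) :=
  measurable A /\ mu A = 0%E.
suff [] : P mesh_lines by [].
apply: (big_ind P).
- by split; [exact: measurable0|exact: measure0].
- move=> A B [mA A0] [mB B0]; split; first exact: measurableU.
  by rewrite measureU0.
- by move=> ij /lineP[cl l0]; split => //; exact: closed_plane_measurable.
Qed.

Lemma mesh_interior_open : open mesh_interior.
Proof. by apply: openI => //; exact/closed_openC/mesh_lines_closed. Qed.

Lemma mesh_interior_finite : (mu mesh_interior < +oo)%E.
Proof.
apply: (@le_lt_trans _ _ (mu Omega)); last exact: plane_measure_bounded.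
apply: le_measure; rewrite ?inE.
- by apply: open_plane_measurable; exact: mesh_interior_open.
- exact: open_plane_measurable.
- by move=> p [].
Qed.

Lemma mesh_det2_neq0 i j k : i != j -> k != i -> k != j ->
  [set i; j; k]%SET \in T -> det2 (x i) (x j) (x k) != 0.
Proof.
move=> ij ki kj tT; apply/eqP => /collinearE.
exact: mesh_nondegenerate meshT _ _ _ tT.
Qed.

Lemma mesh_triangle t : t \in T -> exists i j k,
  [/\ t = [set i; j; k]%SET, i != j, k != i & k != j].
Proof.
move=> tT; have t3 := mesh_card3 meshT tT.
have /card_gt0P[i it] : (0 < #|t|)%N by rewrite t3.
have /card_gt0P[j] : (0 < #|t :\ i|)%N.
  by have := cardsD1 i t; rewrite t3 it; lia.
rewrite !inE => /andP[ji jt].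
by have [|k [tE ki kj]] := set3_of_card3 t3 it jt;
  [rewrite eq_sym|exists i, j, k; rewrite eq_sym].
Qed.

(** The barycentric coordinates are continuous, so they stay positive near [p] and serve there as
    convex weights. *)
Lemma bary_gt0_nbhs i j k p : i != j -> k != i -> k != j ->
  [set i; j; k]%SET \in T ->
  0 < bary (x i) (x j) (x k) p -> 0 < bary (x j) (x k) (x i) p ->
  0 < bary (x k) (x i) (x j) p -> nbhs p (node_hull x [set i; j; k]%SET).
Proof.
move=> ij ki kj tT bi bj bk; have d0 := mesh_det2_neq0 ij ki kj tT.
have near_gt0 a b c : 0 < bary a b c p -> \forall q \near p, 0 < bary a b c q.
  move=> b0; apply: (@bary_continuous R a b c p [set y | 0 < y]).
  exact: lt_nbhsr.
near=> q; apply/node_hull3P => //.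
exists (bary (x i) (x j) (x k) q), (bary (x j) (x k) (x i) q),
  (bary (x k) (x i) (x j) q); split.
- by apply: ltW; near: q; exact: near_gt0.
- by apply: ltW; near: q; exact: near_gt0.
- by apply: ltW; near: q; exact: near_gt0.
- exact: bary_sum.
- exact: bary_comb.
Unshelve. all: by end_near. Qed.

(** The weights are the barycentric coordinates; if one were zero, the point would lie on the line
    through the other two vertices. *)
Lemma mesh_off_lines t (w : 'I_n -> R) :
  t \in T -> (forall l, 0 <= w l) -> \sum_(l in t) w l = 1 ->
  ~ mesh_lines (\sum_(l in t) w l *: x l) ->
  nbhs (\sum_(l in t) w l *: x l) (node_hull x t) /\
  (forall l, l \in t -> 0 < w l).
Proof.
move=> tT w0 w1; set p := \sum_(_ in _) _ => nl.
have [i [j [k [tE ij ki kj]]]] := mesh_triangle tT.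
rewrite tE in tT *.
have d0 := mesh_det2_neq0 ij ki kj tT.
have d1 : det2 (x j) (x k) (x i) != 0 by rewrite det2_cycle.
have d2 : det2 (x k) (x i) (x j) != 0 by rewrite det2_cycle det2_cycle.
move: w1; rewrite tE sum_set3// => w1.
have pE : p = w i *: x i + w j *: x j + w k *: x k by rewrite /p tE sum_set3.
have bi : bary (x i) (x j) (x k) p = w i by rewrite pE bary_of_comb.
have bj : bary (x j) (x k) (x i) p = w j.
  by rewrite pE -addrA addrC bary_of_comb//; lra.
have bk : bary (x k) (x i) (x j) p = w k.
  by rewrite pE addrC addrA bary_of_comb//; lra.
have pos a b c : b != c -> bary (x a) (x b) (x c) p = w a ->
    det2 (x a) (x b) (x c) != 0 -> 0 < w a.
  move=> bc + dn0; have := w0 a; rewrite le_eqVlt => /orP[/eqP <-|//].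
  move=> /eqP; rewrite /bary mulf_eq0 invr_eq0 (negbTE dn0) orbF => /eqP b0.
  exfalso; apply: nl; apply/mesh_linesP; exists b, c; split => //.
  by apply/collinearE; rewrite det2_cycle.
have wi : 0 < w i by apply: pos bi d0; rewrite eq_sym.
have wj : 0 < w j by apply: pos bj d1.
have wk : 0 < w k by apply: pos bk d2.
split; first by apply: bary_gt0_nbhs; rewrite ?bi ?bj ?bk.
by move=> l; rewrite !inE => /orP[/orP[]|] /eqP ->.
Qed.

Lemma mesh_triangle_nbhs t : t \in T -> exists p : R * R, nbhs p (node_hull x t).
Proof.
move=> tT; have [i [j [k [tE ij ki kj]]]] := mesh_triangle tT.
rewrite tE in tT *.
have d0 := mesh_det2_neq0 ij ki kj tT.
have d1 : det2 (x j) (x k) (x i) != 0 by rewrite det2_cycle.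
have d2 : det2 (x k) (x i) (x j) != 0 by rewrite det2_cycle det2_cycle.
(* The centroid, whose three barycentric coordinates are equal and positive. *)
pose p := 3^-1 *: x i + 3^-1 *: x j + 3^-1 *: x k.
have e1 : 3^-1 + 3^-1 + 3^-1 = 1 :> R by field.
exists p; apply: bary_gt0_nbhs => //.
- by rewrite bary_of_comb// invr_gt0.
- by rewrite /p -addrA addrC bary_of_comb// invr_gt0.
- by rewrite /p addrC addrA bary_of_comb// invr_gt0.
Qed.

Lemma mesh_interior_hull p : mesh_interior p ->
  exists2 t, t \in T & node_hull x t p.
Proof.
move=> [Op nl].
have : closure Omega p by exact: subset_closure.
by rewrite (mesh_cover meshT) => -[t /= tT pt]; exists t.
Qed.

(** The interior of the triangle meets the closure of [Omega], hence [Omega], in a nonempty open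
    set; this set has positive measure and cannot be covered by the null set of lines. *)
Lemma mesh_triangle_interior t : t \in T ->
  exists p, mesh_interior p /\ node_hull x t p.
Proof.
move=> tT; have [p0 p0t] := mesh_triangle_nbhs tT.
have clp0 : closure Omega p0.
  by rewrite (mesh_cover meshT); exists t => //; exact: nbhs_singleton p0t.
pose U := interior (node_hull x t) `&` Omega.
have oU : open U by apply: openI => //; exact: open_interior.
have [q [Oq qt]] : (Omega `&` interior (node_hull x t)) !=set0.
  by apply: clp0; exact: nbhs_interior.
have U0 : (0 < mu U)%E by apply: (plane_measure_gt0 oU (p := q)); split.
apply: contrapT => /forallNP noW.
suff : (mu U <= 0)%E by rewrite leNgt U0.
rewrite -mesh_lines_null; apply: le_measure; rewrite ?inE.
- exact: open_plane_measurable.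
- exact: mesh_lines_measurable.
move=> p [pt Op]; apply: contrapT => nl; apply: (noW p); split => //.
exact: interior_subset pt.
Qed.

End mesh.

(** * Values and gradients of the basis functions on the triangles *)

Section P1.
Variables (R : realType) (Omega : set (R * R)) (n : nat).
Variables (x : 'I_n -> R * R) (T : {set {set 'I_n}}).
Variable phi : 'I_n -> R * R -> R.
Hypothesis oOmega : open Omega.
Hypothesis meshT : triangular_mesh Omega x T.
Hypothesis basis_phi : P1_basis Omega x T phi.

(** Choice collects the affine formulas of all triangles; [g t i] becomes the constant gradient of
    [phi i] on [t]. *)
Lemma P1_gradients : exists (c : {set 'I_n} -> 'I_n -> R)
    (g : {set 'I_n} -> 'I_n -> R * R),
  forall t i p, t \in T -> node_hull x t p -> phi i p = c t i + dot (g t i) p.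
Proof.
have /choice[h hP] : forall ti : {set 'I_n} * 'I_n, exists cg : R * (R * R),
    ti.1 \in T -> forall p, node_hull x ti.1 p ->
      phi ti.2 p = cg.1 + dot cg.2 p.
  move=> [t i]; have [tT|tT] := boolP (t \in T); last by exists (0, (0, 0)).
  have [_ /(_ t tT)[c [g cgP]] _] := basis_phi i.
  by exists (c, g) => _ p /cgP.
exists (fun t i => (h (t, i)).1), (fun t i => (h (t, i)).2) => t i p tT.
exact: hP (t, i) tT p.
Qed.

Lemma P1_node i j : phi i (x j) = (i == j)%:R.
Proof. by have [_ _ ->] := basis_phi i. Qed.

(** An affine function commutes with convex combinations, so the nodal values decide: on a triangle
    the basis functions are the barycentric coordinates. *)
Lemma P1_hull t (w : 'I_n -> R) i : t \in T -> (forall l, 0 <= w l) ->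
  \sum_(l in t) w l = 1 ->
  phi i (\sum_(l in t) w l *: x l) = if i \in t then w i else 0.
Proof.
move=> tT w0 w1; have [c [g cgP]] := P1_gradients.
rewrite (cgP t)//; last by exists w.
have -> : c t i = \sum_(l in t) w l * c t i by rewrite -mulr_suml w1 mul1r.
rewrite dot_sumr -big_split/=.
rewrite (eq_bigr (fun l => w l * (i == l)%:R)); last first.
  move=> l lt; rewrite dotZr -mulrDr -P1_node (cgP t)//.
  exact: node_hull_vertex.
case: ifPn => it.
  rewrite (bigD1 i)//= eqxx mulr1 big1 ?addr0// => l /andP[_].
  by rewrite eq_sym => /negbTE ->; rewrite mulr0.
rewrite big1// => l lt; case: eqVneq => [il|]; last by rewrite mulr0.
by rewrite il lt in it.
Qed.

Lemma P1_bounds t i p : t \in T -> node_hull x t p -> 0 <= phi i p <= 1.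
Proof.
move=> tT [w [w0 w1 ->]]; rewrite P1_hull//.
case: ifPn => it; last by rewrite lexx ler01.
by rewrite w0/= -w1 (bigD1 i)//= lerDl sumr_ge0.
Qed.

Lemma P1_eq0 t i p : t \in T -> node_hull x t p -> i \notin t -> phi i p = 0.
Proof. by move=> tT [w [w0 w1 ->]] /negbTE it; rewrite P1_hull// it. Qed.

Lemma P1_gt0 t i p : t \in T -> mesh_interior Omega x p -> node_hull x t p ->
  i \in t -> 0 < phi i p.
Proof.
move=> tT [_ nl] [w [w0 w1 pE]] it; rewrite pE in nl *.
by rewrite P1_hull// it; exact: (mesh_off_lines meshT tT w0 w1 nl).2.
Qed.

Variables (c : {set 'I_n} -> 'I_n -> R) (g : {set 'I_n} -> 'I_n -> R * R).
Hypothesis cgP : forall t i p, t \in T -> node_hull x t p ->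
  phi i p = c t i + dot (g t i) p.

Lemma P1_local t p : t \in T -> mesh_interior Omega x p -> node_hull x t p ->
  \forall q \near p, node_hull x t q /\ forall i, gradient (phi i) q = g t i.
Proof.
move=> tT [_ nl] [w [w0 w1 pE]]; rewrite pE in nl *.
have [pt _] := mesh_off_lines meshT tT w0 w1 nl.
(* For [q] interior to the triangle the affine formula holds near [q] as well, so the gradient can
   be computed at [q] and not only at [p]. *)
have := nbhs_interior pt; apply: filterS => q qt.
split; first exact: interior_subset qt.
move=> i; apply: (@gradient_affine _ _ (c t i)).
by move: qt; apply: filterS => q' /cgP; exact.
Qed.

Lemma P1_continuous i p : mesh_interior Omega x p -> {for p, continuous (phi i)}.
Proof.
move=> Wp; have [t tT pt] := mesh_interior_hull meshT Wp.
apply: (@continuous_affine _ _ (c t i) (g t i)).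
by have := P1_local tT Wp pt; apply: filterS => q [qt _]; exact: cgP.
Qed.

Lemma P1_gradient t i p : t \in T -> mesh_interior Omega x p ->
  node_hull x t p -> gradient (phi i) p = g t i.
Proof. by move=> tT Wp pt; have /nbhs_singleton[_ ->] := P1_local tT Wp pt. Qed.

Lemma P1_gradient_continuous i j p : mesh_interior Omega x p ->
  {for p, continuous (fun q => dot (gradient (phi j) q) (gradient (phi i) q))}.
Proof.
move=> Wp; have [t tT pt] := mesh_interior_hull meshT Wp.
rewrite /prop_for /continuous_at !(P1_gradient _ tT Wp pt).
apply: cvg_near_cst.
by have := P1_local tT Wp pt; apply: filterS => q [_ gE]; rewrite !gE.
Qed.

(** Makes the gradients dual to the edge vectors, and lets a zero gradient equate nodal values. *)
Lemma P1_gradient_diff t i k l : t \in T -> k \in t -> l \in t ->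
  dot (g t i) (x k - x l) = (i == k)%:R - (i == l)%:R.
Proof.
move=> tT kt lt; rewrite dotBr -!P1_node (cgP _ tT (node_hull_vertex x kt)).
by rewrite (cgP _ tT (node_hull_vertex x lt)); ring.
Qed.

End P1.

(** * Mass and stiffness matrices *)

(** Integrability is part of the induction because additivity of the integral needs it for the
    remaining sum. *)
Lemma Rintegral_sum d (T : measurableType d) (R : realType)
    (mu : {measure set T -> \bar R}) (D : set T) (I : Type) (s : seq I)
    (F : I -> T -> R) : measurable D ->
  (forall i, mu.-integrable D (EFin \o F i)) ->
  mu.-integrable D (EFin \o (fun y => \sum_(i <- s) F i y)) /\
  \int[mu]_(y in D) (\sum_(i <- s) F i y) = \sum_(i <- s) \int[mu]_(y in D) F i y.
Proof.
move=> mD intF; elim: s => [|i s [ints IH]].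
  have -> : (fun y => \sum_(i <- [::]) F i y) = cst 0.
    by apply/funext => y; rewrite big_nil.
  by rewrite big_nil Rintegral_cst// mul0r; split => //; exact: integrable0.
have -> : (fun y => \sum_(j <- i :: s) F j y) =
    (fun y => F i y + \sum_(j <- s) F j y).
  by apply/funext => y; rewrite big_cons.
rewrite big_cons -IH; split; last exact: RintegralD.
by have := integrableD mD (intF i) ints; apply: eq_integrable.
Qed.

Section P1_matrices.
Variables (R : realType) (Omega : set (R * R)) (n : nat).
Variables (x : 'I_n -> R * R) (T : {set {set 'I_n}}).
Variable phi : 'I_n -> R * R -> R.
Hypothesis oOmega : open Omega.
Hypothesis bOmega : bounded_set Omega.
Hypothesis meshT : triangular_mesh Omega x T.
Hypothesis basis_phi : P1_basis Omega x T phi.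

Local Notation mu := (@plane_measure R).
Local Notation W := (mesh_interior Omega x).
Local Notation grad i p := (gradient (phi i) p).
Local Notation A := (stiffness Omega phi).
Local Notation M := (mass Omega phi).

Let oW : open W. Proof. exact: mesh_interior_open meshT. Qed.

Let mW : measurable (W : set (measurableTypeR R * measurableTypeR R)).
Proof. exact: open_plane_measurable. Qed.

Let Woo : (mu W < +oo)%E. Proof. exact: mesh_interior_finite meshT. Qed.

Lemma mass_integrable i j :
  mu.-integrable (W : set (measurableTypeR R * measurableTypeR R))
    (EFin \o (fun p => phi j p * phi i p)).
Proof.
have [c [g cgP]] := P1_gradients basis_phi.
apply: (@plane_integrable _ _ _ 1) => // p Wp.
  by apply: cvgM; exact: P1_continuous cgP _ _ Wp.
have [t tT pt] := mesh_interior_hull meshT Wp.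
have /andP[i0 i1] := P1_bounds basis_phi i tT pt.
have /andP[j0 j1] := P1_bounds basis_phi j tT pt.
by rewrite ger0_norm ?mulr_ge0// mulr_ile1.
Qed.

Lemma stiffness_integrable i j :
  mu.-integrable (W : set (measurableTypeR R * measurableTypeR R))
    (EFin \o (fun p => dot (grad j p) (grad i p))).
Proof.
have [c [g cgP]] := P1_gradients basis_phi.
(* The integrand takes one value per triangle; the sum of all absolute values is a uniform bound. *)
apply: (@plane_integrable _ _ _ (\sum_(t in T) `|dot (g t j) (g t i)|)) => // p Wp.
  exact: P1_gradient_continuous cgP _ _ _ Wp.
have [t tT pt] := mesh_interior_hull meshT Wp.
rewrite !(P1_gradient meshT cgP _ tT Wp pt).
by rewrite (bigD1 t)//= lerDl sumr_ge0.
Qed.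

Lemma massE i j : M i j = \int[mu]_(p in W) (phi j p * phi i p).
Proof.
rewrite mxE; apply: Rintegral_setD_null.
- exact: mesh_lines_measurable meshT.
- exact: mesh_lines_null meshT.
Qed.

Lemma stiffnessE i j :
  A i j = \int[mu]_(p in W) dot (grad j p) (grad i p).
Proof.
rewrite mxE; apply: Rintegral_setD_null.
- exact: mesh_lines_measurable meshT.
- exact: mesh_lines_null meshT.
Qed.

Lemma mass_ge0 i j : 0 <= M i j.
Proof.
rewrite massE; apply: Rintegral_ge0 => p Wp.
have [t tT pt] := mesh_interior_hull meshT Wp.
have /andP[i0 _] := P1_bounds basis_phi i tT pt.
have /andP[j0 _] := P1_bounds basis_phi j tT pt.
exact: mulr_ge0.
Qed.

(** Both basis functions are positive at a point of [t] off the lines. The contrapositive shows that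
    nonadjacent distinct nodes share no triangle. *)
Lemma mass_gt0 i j t : t \in T -> i \in t -> j \in t -> 0 < M i j.
Proof.
move=> tT it jt; rewrite massE.
have [p [Wp pt]] := mesh_triangle_interior oOmega meshT tT.
have [c [g cgP]] := P1_gradients basis_phi.
apply: (plane_Rintegral_gt0 oW Wp (mass_integrable i j)).
- move=> q Wq; have [t' tT' qt] := mesh_interior_hull meshT Wq.
  have /andP[i0 _] := P1_bounds basis_phi i tT' qt.
  have /andP[j0 _] := P1_bounds basis_phi j tT' qt.
  exact: mulr_ge0.
- by apply: cvgM; exact: P1_continuous cgP _ _ Wp.
- by rewrite mulr_gt0// (P1_gt0 meshT basis_phi tT).
Qed.

Lemma gradient_eq0 i t p : t \in T -> W p -> node_hull x t p -> i \notin t ->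
  grad i p = 0.
Proof.
move=> tT Wp pt it.
have [c [g cgP]] := P1_gradients basis_phi.
have nt := P1_local meshT cgP tT Wp pt.
apply: (@gradient_affine _ _ 0); apply: filterS nt => q [qt _].
by rewrite (P1_eq0 basis_phi tT qt it) /dot !mul0r !addr0.
Qed.

Lemma stiffness_eq0 i j :
  (forall t, t \in T -> i \in t -> j \notin t) -> A i j = 0.
Proof.
move=> ij; rewrite stiffnessE /Rintegral integral0_eq// => p Wp.
have [t tT pt] := mesh_interior_hull meshT Wp.
have [it|it] := boolP (i \in t).
  by rewrite (gradient_eq0 tT Wp pt (ij t tT it)) dotC dot0r.
by rewrite (gradient_eq0 tT Wp pt it) dot0r.
Qed.

(** On a triangle with vertices [i], [j] and [k], the two gradients are dual to the edge vectors
    from [k], which meet at a nonobtuse angle. On any other triangle one gradient is zero. *)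
Lemma gradient_nonobtuse i j t p : nonobtuse_mesh x T -> i != j ->
  t \in T -> W p -> node_hull x t p -> dot (grad j p) (grad i p) <= 0.
Proof.
move=> nobt ij tT Wp pt.
have [it|it] := boolP (i \in t); last by rewrite (gradient_eq0 tT Wp pt it) dot0r.
have [jt|jt] := boolP (j \in t); last first.
  by rewrite (gradient_eq0 tT Wp pt jt) dotC dot0r.
have [c [g cgP]] := P1_gradients basis_phi.
rewrite !(P1_gradient meshT cgP _ tT Wp pt).
have [k [tE ki kj]] := set3_of_card3 (mesh_card3 meshT tT) it jt ij.
have kt : k \in t by rewrite tE !inE eqxx orbT.
apply: (@dual_basis_dot_le0 _ (x j - x k) (x i - x k));
  rewrite ?(P1_gradient_diff basis_phi cgP)//.
- by rewrite eqxx eq_sym (negbTE kj) subr0.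
- by rewrite eq_sym (negbTE ij) eq_sym (negbTE kj) subr0.
- by rewrite (negbTE ij) eq_sym (negbTE ki) subr0.
- by rewrite eqxx eq_sym (negbTE ki) subr0.
apply/angle_nonobtuse/nobt; suff -> : [set k; j; i]%SET = t by [].
by rewrite tE; apply/setP => l; rewrite !inE orbC orbA orbAC.
Qed.

Lemma stiffness_le0 i j : nonobtuse_mesh x T -> i != j -> A i j <= 0.
Proof.
move=> nobt ij; rewrite -oppr_ge0 stiffnessE -mulN1r -RintegralZl//; last first.
  exact: stiffness_integrable.
apply: Rintegral_ge0 => p Wp.
have [t tT pt] := mesh_interior_hull meshT Wp.
by rewrite mulN1r oppr_ge0 (gradient_nonobtuse nobt ij tT Wp pt).
Qed.

(** Serves both matrices, with [f] the integrands of the mass or of the stiffness entries. *)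
Lemma quadratic_form_integral (f : 'I_n -> 'I_n -> R * R -> R) (v : 'I_n -> R) :
  (forall i j, mu.-integrable (W : set (measurableTypeR R * measurableTypeR R))
     (EFin \o f i j)) ->
  let q p := \sum_i \sum_j v i * v j * f i j p in
  mu.-integrable (W : set (measurableTypeR R * measurableTypeR R)) (EFin \o q) /\
  \int[mu]_(p in W) q p = \sum_i \sum_j v i * v j * \int[mu]_(p in W) f i j p.
Proof.
move=> intf q.
have intvf i j : mu.-integrable
    (W : set (measurableTypeR R * measurableTypeR R))
    (EFin \o (fun p => v i * v j * f i j p)).
  by have := integrableZl mW (v i * v j) (intf i j); apply: eq_integrable.
have ints i := Rintegral_sum (index_enum 'I_n) mW (intvf i).
have [intq ->] := Rintegral_sum (index_enum 'I_n) mW (fun i => (ints i).1).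
split => //; apply: eq_bigr => i _; rewrite (ints i).2.
by apply: eq_bigr => j _; rewrite RintegralZl.
Qed.

(** The form is the integral of the square of the P1 function with nodal values [v]. *)
Lemma mass_form_ge0 (v : 'I_n -> R) : 0 <= \sum_i \sum_j v i * v j * M i j.
Proof.
have [_ E] := quadratic_form_integral v mass_integrable.
have -> : \sum_i \sum_j v i * v j * M i j =
    \sum_i \sum_j v i * v j * \int[mu]_(p in W) (phi j p * phi i p).
  by apply: eq_bigr => i _; apply: eq_bigr => j _; rewrite massE.
rewrite -E; apply: Rintegral_ge0 => p _.
have -> : \sum_i \sum_j v i * v j * (phi j p * phi i p) =
    (\sum_i v i * phi i p) * (\sum_j v j * phi j p).
  rewrite mulr_suml; apply: eq_bigr => i _; rewrite mulr_sumr.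
  by apply: eq_bigr => j _; ring.
by rewrite -expr2 sqr_ge0.
Qed.

(** The form integrates the squared gradient norm [q] of the P1 function with nodal values [v]. A
    nonzero gradient on one triangle would make the integral positive, so the gradient vanishes on
    each triangle. *)
Lemma stiffness_form_le0 (v : 'I_n -> R) : \sum_i \sum_j v i * v j * A i j <= 0 ->
  forall t k l, t \in T -> k \in t -> l \in t -> v k = v l.
Proof.
move=> vAv t k l tT kt lt.
have [intq E] := quadratic_form_integral v stiffness_integrable.
set q := fun p => \sum_i \sum_j _ in intq E.
have qE p : q p = dot (\sum_j v j *: grad j p) (\sum_i v i *: grad i p).
  rewrite /q dot_sumr; apply: eq_bigr => i _; rewrite dotZr dot_suml mulr_sumr.
  by apply: eq_bigr => j _; rewrite dotZl mulrA.
have [c [g cgP]] := P1_gradients basis_phi.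
have [p [Wp pt]] := mesh_triangle_interior oOmega meshT tT.
have Gp : \sum_i v i *: grad i p = \sum_i v i *: g t i.
  by apply: eq_bigr => i _; rewrite (P1_gradient meshT cgP _ tT Wp pt).
have qp0 : q p = 0.
  apply/eqP; rewrite eq_le [X in _ && (_ <= X)]qE dot_ge0 andbT leNgt.
  apply/negP => qp; move: vAv; rewrite leNgt => /negP; apply.
  have -> : \sum_i \sum_j v i * v j * A i j = \int[mu]_(p in W) q p.
    by rewrite E; apply: eq_bigr => i _; apply: eq_bigr => j _; rewrite stiffnessE.
  apply: (plane_Rintegral_gt0 oW Wp intq _ _ qp) => [r _|].
    by rewrite qE dot_ge0.
  (* [q] is continuous at [p] because it is constant near [p]. *)
  apply: cvg_near_cst; have := P1_local meshT cgP tT Wp pt.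
  apply: filterS => r [_ gE]; rewrite !qE Gp.
  have -> // : \sum_i v i *: grad i r = \sum_i v i *: g t i.
  by apply: eq_bigr => i _; rewrite gE.
have G0 : \sum_i v i *: g t i = 0 by apply: dot_eq0; rewrite -Gp -qE.
have vE m : \sum_i v i * (i == m)%:R = v m.
  rewrite (bigD1 m)//= eqxx mulr1 big1 ?addr0// => i /negbTE ->.
  by rewrite mulr0.
(* The difference of the nodal values is the zero gradient paired with the edge vector
   [x k - x l]. *)
apply/eqP; rewrite -subr_eq0 -!vE -sumrB.
rewrite (eq_bigr (fun i => dot (v i *: g t i) (x k - x l))) => [|i _].
  by rewrite -dot_suml G0 dotC dot0r.
by rewrite dotZl (P1_gradient_diff basis_phi cgP)// mulrBr.
Qed.

Lemma node_not_boundary i : ~ boundary Omega (x i) -> Omega (x i).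
Proof.
move=> nb; apply: contrapT => nO; apply: nb; split; last by move/interior_subset.
have [t tT it] := mesh_node_vertex meshT i.
by rewrite (mesh_cover meshT); exists t => //; exact: node_hull_vertex.
Qed.

(* Among the nodes where [v] is nonzero, one with the largest first coordinate
   is a local maximum of this coordinate on the domain. *)
Lemma P1_constant_eq0 (v : 'I_n -> R) :
  (forall t k l, t \in T -> k \in t -> l \in t -> v k = v l) ->
  (forall i, boundary Omega (x i) -> v i = 0) -> forall i, v i = 0.
Proof.
move=> vcst vb i0; apply/eqP/contraT => vi0.
case: (@arg_maxP _ _ _ i0 (fun i => v i != 0) (fun i => (x i).1) vi0) => i vi imax.
have Oi : Omega (x i).
  by apply: node_not_boundary => /vb/eqP; rewrite (negbTE vi).
(* Continuity is given relative to the closure of [Omega]; at a point of the open set [Omega] it is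
   ordinary continuity. *)
have phic : {for x i, continuous (phi i)}.
  have [phiw _ _] := basis_phi i.
  have := continuous_subspaceW (@subset_closure _ Omega) phiw.
  by rewrite continuous_open_subspace//; apply; rewrite inE.
have /nbhs_ballP[e /= e0 eU] : nbhs (x i) (Omega `&` [set q | 0 < phi i q]).
  apply: filterI; first exact: open_nbhs_nbhs.
  by apply: (phic [set y | 0 < y]); apply: lt_nbhsr; rewrite (P1_node basis_phi) eqxx.
(* A point to the right of [x i], close enough that [phi i] is still positive; any triangle
   containing it must have [i] as a vertex. *)
pose q : R * R := ((x i).1 + e / 2, (x i).2).
have [Oq phiq] : (Omega `&` [set q | 0 < phi i q]) q.
  apply: eU; split; rewrite /ball /= /q /=; last by rewrite subrr normr0.
  by rewrite opprD addNKr normrN gtr0_norm; lra.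
have : closure Omega q by exact: subset_closure.
rewrite (mesh_cover meshT) => -[t /= tT qt].
have it : i \in t.
  apply: contraT => it; move: phiq => /=.
  by rewrite (P1_eq0 basis_phi tT qt it) ltxx.
have [w [w0 w1 qE]] := qt.
suff : q.1 <= (x i).1 by rewrite /q /=; lra.
have -> : q.1 = \sum_(l in t) w l * (x l).1.
  by rewrite qE (big_morph fst (id1 := 0) (op1 := +%R)).
have -> : (x i).1 = \sum_(l in t) w l * (x i).1 by rewrite -mulr_suml w1 mul1r.
(* As [v] is constant on [t], each vertex [l] carries the nonzero value [v i], and so competes in
   the maximum that selects [i]. *)
apply: ler_sum => l lt; apply: ler_wpM2l => //; apply: imax.
by rewrite (vcst t l i).
Qed.

End P1_matrices.

(** * Zero forcing and inner solutions *)

(** In the row of the forcing vertex, blue terms vanish by induction, and white terms other than the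
    forced one have coefficient zero. The diagonal is left free, the forcing vertex being blue
    itself. *)
Lemma colouring_kernel (F : fieldType) (n : nat) (e : rel 'I_n) (N : 'M[F]_n)
    (v : 'cV[F]_n) (S C : {set 'I_n}) :
  (forall i j, e i j -> N i j != 0) ->
  (forall i j, i != j -> ~~ e i j -> N i j = 0) -> N *m v = 0 ->
  (forall i, i \in S -> v i 0 = 0) -> colouring e S C ->
  forall i, i \in C -> v i 0 = 0.
Proof.
move=> eN Ne Nv vS; elim=> [//|{}C i j _ IH iC eij] k.
have [->|kj] := eqVneq k j; last by rewrite !inE (negbTE kj) => /IH.
move=> _; have := congr1 (fun B : 'cV_n => B i 0) Nv; rewrite !mxE (bigD1 j)//=.
have : j \in ([set u | e i u] :\: C)%SET by rewrite eij finset.set11.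
rewrite !inE => /andP[_ /eN Nij].
rewrite big1 ?addr0 => [/eqP|l lj].
  by rewrite mulf_eq0 (negbTE Nij) => /eqP.
have [/IH ->|lC] := boolP (l \in C); first by rewrite mulr0.
rewrite Ne ?mul0r//; first by apply: contraNneq lC => <-.
have : l \notin ([set u | e i u] :\: C)%SET by rewrite eij inE.
by rewrite !inE lC.
Qed.

Section inner_solutions.
Variables (R : realType) (nI nB : nat) (A M : 'M[R]_(nI + nB)) (lambda : R).

(** The two defining kernels are the upper and lower block rows; the right blocks only meet the zero
    part of the vector. *)
Lemma inner_solution_kernel (u : 'cV[R]_nI) : u \in inner_solutions A M lambda ->
  (A - lambda *: M) *m col_mx u 0 = 0.
Proof.
rewrite memv_cap !memv_ker !lfunE/= => /andP[/eqP uI /eqP uB].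
rewrite -[A]submxK -[M]submxK scale_block_mx opp_block_mx add_block_mx.
by rewrite mul_block_col !mulmx0 !addr0 uI uB col_mx0.
Qed.

Lemma inner_solution_forms (u : 'cV[R]_nI) (v := col_mx u (0 : 'cV[R]_nB)) :
  u \in inner_solutions A M lambda ->
  \sum_i \sum_j v i 0 * v j 0 * A i j =
  lambda * \sum_i \sum_j v i 0 * v j 0 * M i j.
Proof.
move=> /inner_solution_kernel; rewrite -/v => Nv.
rewrite mulr_sumr; apply: eq_bigr => i _.
have := congr1 (fun B : 'cV_(nI + nB) => v i 0 * B i 0) Nv.
rewrite !mxE mulr0 mulr_sumr => Nvi.
apply/eqP; rewrite mulr_sumr -subr_eq0 -sumrB -[X in _ == X]Nvi; apply/eqP.
by apply: eq_bigr => j _; rewrite !mxE; ring.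
Qed.

(** Restricting the extended vector to [S] is linear, and injective on inner solutions, with values
    in a space of dimension [#|S|]. *)
Lemma dim_inner_solutions_le (S : {set 'I_(nI + nB)}) :
  (forall u, u \in inner_solutions A M lambda ->
    (forall i, i \in S -> col_mx u (0 : 'cV[R]_nB) i 0 = 0) -> u = 0) ->
  (\dim (inner_solutions A M lambda) <= #|S|)%N.
Proof.
move=> uS.
pose f (u : 'cV[R]_nI) : 'rV[R]_#|S| :=
  \row_i col_mx u (0 : 'cV[R]_nB) (enum_val i) 0.
have flin : linear f.
  move=> a u w; apply/rowP => i; rewrite !mxE.
  by case: splitP => j _; rewrite !mxE// mulr0 addr0.
pose fL := linfun
  (HB.pack f (GRing.isLinear.Build _ _ _ _ f flin) : {linear _ -> _}).
rewrite -(@limg_dim_eq _ _ _ fL); last first.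
  apply/eqP; rewrite -subv0; apply/subvP => u.
  rewrite memv_cap memv_ker lfunE/= memv0 => /andP[uin /eqP fu].
  apply/eqP/uS => // i iS.
  have := congr1 (fun B : 'rV_#|S| => B 0 (enum_rank_in iS i)) fu.
  by rewrite !mxE enum_rankK_in.
apply: leq_trans (dimvS (subvf _)) _.
by rewrite dimvf /dim/= mul1n.
Qed.

End inner_solutions.

Theorem theorem3p7 (R : realType) (Omega : set (R * R)) (nI nB : nat)
    (x : 'I_(nI + nB) -> R * R) (T : {set {set 'I_(nI + nB)}})
    (phi : 'I_(nI + nB) -> R * R -> R)
    (polygonalOmega : polygonal_domain Omega)
    (meshT : triangular_mesh Omega x T)
    (nonobtuseT : nonobtuse_mesh x T)
    (interior_first : interior_nodes_first Omega x)
    (basis_phi : P1_basis Omega x T phi) :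
  let A := stiffness Omega phi in
  let M := mass Omega phi in
  let G := mesh_graph M in
  let B := boundary_nodes Omega x in
  (forall lambda : R,
     (\dim (inner_solutions A M lambda) <= min_zero_forcing_extension G B)%N) /\
  (zero_forcing G B -> unique_continuation A M).
Proof.
move=> A M G B.
have [oOmega _ _ bOmega _] := polygonalOmega.
(* A boundary node falls in the lower block, which is zero, since no index of the upper block is a
   boundary node. *)
have vB u i : i \in B -> col_mx u (0 : 'cV[R]_nB) i 0 = 0.
  rewrite inE => /asboolP; rewrite mxE; case: splitP => j ij; last by rewrite mxE.
  have -> : i = lshift nB j by exact: val_inj.
  by move=> /(interior_first.1 j).
(* Kept general in [S]: a minimizer gives the bound and the empty set gives unique continuation. *)
have dimS lambda S : zero_forcing G (S :|: B)%SET ->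
    (\dim (inner_solutions A M lambda) <= #|S|)%N.
  move=> zS; apply: dim_inner_solutions_le => u uin uS.
  pose v : 'cV[R]_(nI + nB) := col_mx u 0.
  suff v0 i : v i 0 = 0.
    by apply/colP => i; have := v0 (lshift nB i); rewrite col_mxEu mxE.
  (* For [lambda <= 0] the two terms of an edge entry of [A - lambda *: M] may cancel, so forcing is
     replaced by the energy argument. *)
  have [lambda_le0|lambda_gt0] := leP lambda 0.
    move: i; apply: (P1_constant_eq0 oOmega meshT basis_phi); last first.
      by move=> i ib; apply: vB; rewrite inE; apply/asboolP.
    apply: (stiffness_form_le0 oOmega bOmega meshT basis_phi).
    rewrite (inner_solution_forms uin) mulr_le0_ge0//.
    exact: (mass_form_ge0 oOmega bOmega meshT basis_phi (fun i => v i 0)).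
  have NE k l : (A - lambda *: M) k l = A k l - lambda * M k l.
    by rewrite mxE [X in _ + X]mxE [X in - X]mxE.
  apply: (colouring_kernel _ _ (inner_solution_kernel uin) _ zS) => //.
  (* On an edge, [A k l <= 0 < lambda * M k l]. *)
  - move=> k l /andP[kl Mkl]; rewrite NE lt_eqF// subr_lt0.
    apply: (@le_lt_trans _ _ 0); last exact: mulr_gt0.
    exact: (stiffness_le0 oOmega bOmega meshT basis_phi).
  (* Off the edges the mass entry is zero, and the stiffness entry too, because a common triangle
     would make the mass entry positive. *)
  - move=> k l kl; rewrite negb_and kl/= => Mkl.
    have Mkl0 : M k l = 0.
      by apply/eqP; rewrite eq_le leNgt Mkl (mass_ge0 meshT basis_phi).
    rewrite NE Mkl0 mulr0 subr0.
    apply: (stiffness_eq0 meshT basis_phi) => t tT kt.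
    apply: contra Mkl; exact: (mass_gt0 oOmega bOmega meshT basis_phi tT kt).
  - by move=> k; rewrite inE => /orP[/uS|/vB].
split=> [lambda|zB lambda].
  have [[S [_ zS] ->] _] := min_zero_forcing_extensionP G B.
  exact: dimS.
have := dimS lambda finset.set0; rewrite cards0 finset.set0U leqn0 dimv_eq0.
by move=> /(_ zB)/eqP.
Qed.
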